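(* Let $(\Omega, \mathcal{F}, \mu)$ be a probability space. Let $f, g \in L^\infty(\Omega, \mu)$ and $h \in L^1(\Omega, \mu)$ be real-valued measurable functions, and suppose that $\int_\Omega g \, d\mu = 0$. Then $$ \iint_{\Omega \times \Omega} (f(x)+f(y))(g(x)-g(y))h(y) \, d\mu(x) \, d\mu(y) \leq 2 \int_0^\infty f^*(y)\, g^*(y)\, h^*(y) \, dy, $$ where $f^*, g^*, h^*$ denote the decreasing rearrangements of $f, g, h$, respectively.
   Context: For a $\mu$-measurable function $f \colon \Omega \to \mathbb{R}$, the decreasing rearrangement $f^*$ is the nonnegative, decreasing (non-increasing), right-continuous function on $[0,\infty)$ having the same distribution function (with respect to Lebesgue measure) as $|f|$ has with respect to $\mu$; that is, $f^*(t) = \inf\{ s \geq 0 : \mu(\{|f| > s\}) \leq t \}$ for $t \ge 0$. *)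

(* Defs.v *)
From mathcomp Require Import all_boot all_order all_algebra.
From mathcomp Require Import all_classical all_reals all_analysis.

Set Implicit Arguments.
Unset Strict Implicit.
Unset Printing Implicit Defensive.

Import Order.TTheory GRing.Theory Num.Theory.
Import numFieldNormedType.Exports.

Local Open Scope classical_set_scope.
Local Open Scope ring_scope.

(* Valued in the extended reals: for unbounded [f] the infimum at [t = 0] is
   taken over the empty set and equals [+oo]. Only [0 <= t] is meaningful. *)
Definition decreasing_rearrangement (d : measure_display)
    (T : measurableType d) (R : realType) (mu : {measure set T -> \bar R})
    (f : T -> R) (t : R) : \bar R :=
  ereal_inf [set s%:E | s in
    [set s : R | 0 <= s /\ (mu [set x | (s < `|f x|)%R] <= t%:E)%E]].

(* Main.v *)
Require Import Defs.
From mathcomp Require Import all_boot all_order all_algebra.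
From mathcomp Require Import all_classical all_reals all_analysis.
From mathcomp Require Import measurable_realfun ess_sup_inf.
From mathcomp Require Import ring lra.

(** Expanding the product, and using that g has mean zero, the double integral
becomes the trilinear form

  B(f, g, h) = (\int f g) (\int h) - (\int f) (\int g h) - \int f g h.

Bounding its three terms separately would only give the constant 3; the
constant 2 comes from a second use of the mean value of g.

Both sides decompose into layers. The function f is the integral over s >= 0
of sgn(f) 1_{|f| > s}, and likewise for h with levels r, while the right-hand
side is the integral over s and r of twice the integral of the rearrangement
of g over [0, min(mu {|f| > s}, mu {|h| > r})[. It is thus enough to treat
|f| <= 1_A and |h| <= 1_B (trilinear_form_le_indic); le_layerwise, applied once
in h and once in f, does the reduction.

For such f and h, the form can be written

  sigma (\int u g) (\int v) - \int v (u + k) g,   sigma = +1 or -1,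

where v is one of f and h, u is the other, and k is the mean of u up to sign.
Let E be A or B, whichever carries v. Since g has mean zero, \int u g is equal
to \int (u - c) g for every constant c, so this is at most \int |g| W with
W = mu(E) |u - c| + 1_E |u + k| (mean_zero_bilinear_le). The point is that c
can be chosen such that W <= 2 and \int W <= 2 mu(E) (weight_exists). The
Hardy-Littlewood inequality then bounds \int |g| W by twice the integral of
the rearrangement of g over [0, mu(E)[ (weighted_integral_le), and taking for v
either f or h gives the minimum of the two measures. *)

Set Implicit Arguments.
Unset Strict Implicit.
Unset Printing Implicit Defensive.

Import Order.TTheory GRing.Theory Num.Theory.
Import numFieldNormedType.Exports.

Local Open Scope classical_set_scope.
Local Open Scope ring_scope.

(** * Integrals over the sections of a measurable set *)

Section sections.
Local Open Scope ereal_scope.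
Context d1 d2 (X : measurableType d1) (Y : measurableType d2) (R : realType).
Context (m1 : {sigma_finite_measure set X -> \bar R}).
Context (m2 : {sigma_finite_measure set Y -> \bar R}).
Context (C : set (X * Y)) (mC : measurable C).
Context (w : X -> \bar R) (mw : measurable_fun setT w) (w0 : forall x, 0 <= w x).

Let F (z : X * Y) := w z.1 * (\1_C z)%:E.

Let mF : measurable_fun setT F.
Proof.
apply: emeasurable_funM; first exact: measurableT_comp.
by apply/measurable_EFinP; exact: measurable_indic.
Qed.

Let F0 z : 0 <= F z.
Proof. by apply: mule_ge0 => //; rewrite lee_fin. Qed.

Let intFx y : \int[m1]_x F (x, y) = \int[m1]_(x in ysection C y) w x.
Proof.
rewrite [RHS]integral_mkcond; apply: eq_integral => x _.
rewrite /F patchE /= indicE.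
have -> : ((x, y) \in C) = (x \in ysection C y).
  by apply/idP/idP; rewrite !inE => /ysectionP.
by case: ifP => _; rewrite ?mule1 ?mule0.
Qed.

Let intFy x : \int[m2]_y F (x, y) = w x * m2 (xsection C x).
Proof.
rewrite /F/= ge0_integralZl//; last first.
  apply/(measurable_EFinP _ (fun y => \1_C (x, y))).
  by apply: measurableT_comp => //; exact: measurable_indic.
congr (_ * _); rewrite -[in RHS](setIT (xsection C x)) -integral_indic//; last first.
  exact: measurable_xsection.
apply: eq_integral => y _; rewrite !indicE; congr (_ %:R%:E).
by congr nat_of_bool; apply/idP/idP; rewrite !inE => /xsectionP.
Qed.

Lemma measurable_integral_ysection :
  measurable_fun setT (fun y => \int[m1]_(x in ysection C y) w x).
Proof.
under eq_fun do rewrite -intFx.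
exact: measurable_fun_fubini_tonelli_G.
Qed.

(** Both sides are the integral of the weight w over C for the product
measure. The two layer cake formulas below are instances, with C the region
under the graph of |k| and the region under the graph of its distribution
function. *)
Lemma integral_mul_xsection :
  \int[m1]_x (w x * m2 (xsection C x)) =
  \int[m2]_y \int[m1]_(x in ysection C y) w x.
Proof.
under eq_integral do rewrite -intFy.
under [RHS]eq_integral do rewrite -intFx.
exact: fubini_tonelli.
Qed.

End sections.

Lemma lebesgue_measure_co (R : realType) (r : R) : 0 <= r ->
  lebesgue_measure (`[0%R, r[%classic : set R) = r%:E.
Proof.
move=> r0; rewrite lebesgue_measure_itv/= lte_fin sube0; case: ifPn => //.
by rewrite -leNgt => r0'; congr EFin; apply/eqP; rewrite eq_le r0 r0'.
Qed.

Definition superlevel (T : Type) (R : realType) (k : T -> R) (s : R) : set T :=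
  [set x | s < `|k x|].

(** * Layer cake formulas *)

Section layer_cake.
Local Open Scope ereal_scope.
Context d (T : measurableType d) (R : realType) (mu : probability T R).
Local Notation ray := (`[(0%R : R), +oo[%classic : set R).
Implicit Types (k phi theta : T -> R) (rho : R -> \bar R).

Lemma measurable_superlevel k s :
  measurable_fun setT k -> measurable (superlevel k s).
Proof.
move=> mk; rewrite -[superlevel k s]setTI.
rewrite (_ : superlevel k s = (fun x => s < `|k x|)%R @^-1` [set true]).
  by apply: measurable_fun_ltr => //; exact: measurableT_comp.
by apply/seteqP; split => x /=.
Qed.

Lemma fineK_prob (A : set T) : measurable A -> (fine (mu A))%:E = mu A.
Proof. by move=> mA; rewrite fineK// fin_num_measure. Qed.

Lemma le_superlevel k s s' : (s <= s')%R -> superlevel k s' `<=` superlevel k s.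
Proof. by move=> ss' x; exact: le_lt_trans. Qed.

Lemma rearrangement_ge0 k t : 0 <= decreasing_rearrangement mu k t.
Proof. by apply: le_ereal_inf_tmp => _ [s [s0 _] <-]; rewrite lee_fin. Qed.

Let under_graph k : set (T * R) := [set z | (0 <= z.2)%R /\ (z.2 < `|k z.1|)%R].

Let measurable_under_graph k : measurable_fun setT k ->
  measurable (under_graph k : set (T * measurableTypeR R)).
Proof.
move=> mk; rewrite -[under_graph k]setTI.
have -> : under_graph k =
    (fun z : T * R => (0 <= z.2)%R && (z.2 < `|k z.1|)%R) @^-1` [set true].
  by apply/seteqP; split => z /= => [[-> ->]|/andP].
apply: measurable_and => //.
  by apply: measurable_fun_ler => //; exact: measurable_snd.
apply: measurable_fun_ltr; first exact: measurable_snd.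
apply: measurableT_comp => //; apply: measurableT_comp => //.
Qed.

Let ysection_under_graph k s :
  ysection (under_graph k) s = if (0 <= s)%R then superlevel k s else set0.
Proof.
apply/seteqP; split => x.
  by move=> /ysectionP[/= -> ].
by case: ifPn => // s0 sx; apply/ysectionP.
Qed.

Let distribution k (s : R) : R := fine (mu (superlevel k s)).

Let measurable_distribution k : measurable_fun setT k ->
  measurable_fun setT (distribution k).
Proof.
move=> mk; apply: (measurableT_comp (fine_measurable measurableT)).
pose D : set (T * measurableTypeR R) := [set z | (z.2 < `|k z.1|)%R].
have mD : measurable D.
  rewrite -[D]setTI.
  have -> : D = (fun z : T * R => (z.2 < `|k z.1|)%R) @^-1` [set true] by [].
  apply: measurable_fun_ltr => //.
  by apply: measurableT_comp => //; exact: measurableT_comp.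
have := measurable_fun_ysection mu mD.
congr (measurable_fun _ _); apply/funext => s /=; congr (mu _).
by apply/seteqP; split => x; [move/ysectionP|move=> ?; apply/ysectionP].
Qed.

(** The distribution function s |-> mu {|k| > s} is non-increasing, so the set
of levels at which it exceeds t is an interval starting at 0, and the infimum
defining the rearrangement is its right end. This expresses the rearrangement
as a length, which makes it measurable in t and accessible to Tonelli's
theorem. *)
Lemma rearrangementE k t : measurable_fun setT k ->
  decreasing_rearrangement mu k t =
  lebesgue_measure [set s | (0 <= s)%R /\ (t < fine (mu (superlevel k s)))%R].
Proof.
move=> mk; set S := [set s | _].
have mS : measurable S.
  rewrite -[S]setTI.
  have -> : S = (fun s : R => (0 <= s)%R && (t < distribution k s)%R) @^-1` [set true].
    by apply/seteqP; split => z /= => [[-> ->]|/andP].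
  apply: measurable_and => //; first exact: measurable_fun_ler.
  by apply: measurable_fun_ltr => //; exact: measurable_distribution.
have notS s : (0 <= s)%R -> ~ S s -> mu (superlevel k s) <= t%:E.
  move=> s0 nS; rewrite -fineK_prob ?lee_fin; last exact: measurable_superlevel.
  by rewrite leNgt; apply/negP => ts; apply: nS.
apply/eqP; rewrite eq_le; apply/andP; split; last first.
  apply: le_ereal_inf_tmp => _ [s [s0 smu] <-].
  have <- : lebesgue_measure (`[0%R, s]%classic : set R) = s%:E.
    rewrite lebesgue_measure_itv/= lte_fin sube0; case: ifPn => //.
    by rewrite -leNgt => s0'; congr EFin; apply/eqP; rewrite eq_le s0 s0'.
  apply: le_measure; rewrite ?inE// => r [r0 tr] /=.
  rewrite in_itv/= r0/= leNgt; apply/negP => sr; move: tr; apply/negP.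
  rewrite -leNgt -lee_fin fineK_prob; last exact: measurable_superlevel.
  apply: le_trans smu; apply: le_measure; rewrite ?inE; try exact: measurable_superlevel.
  exact/le_superlevel/ltW.
have below s : (0 <= s)%R -> s%:E < decreasing_rearrangement mu k t -> S s.
  move=> s0 sk; apply: contrapT => /(notS _ s0) smu; move: sk; apply/negP.
  by rewrite -leNgt; apply: ereal_inf_lbound; exists s.
have := rearrangement_ge0 k t.
case: (decreasing_rearrangement mu k t) below => [r| |] // below r0.
- rewrite -(lebesgue_measure_co (r := r)) -?lee_fin//.
  apply: le_measure; rewrite ?inE// => s /=; rewrite in_itv/= => /andP[s0 sr].
  by apply: below => //; rewrite lte_fin.
- rewrite (_ : +oo = lebesgue_measure `[0%R, +oo[%classic); last first.
    by rewrite lebesgue_measure_itv/= ltry.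
  apply: le_measure; rewrite ?inE// => s /=; rewrite in_itv/= andbT => s0.
  by apply: below => //; rewrite ltry.
Qed.

Let layer k theta s := \int[mu]_(x in superlevel k s) (theta x)%:E.

Let integral_ysectionE k theta :
  (fun s => \int[mu]_(x in ysection (under_graph k) s) (theta x)%:E) =
  layer k theta \_ `[0%R, +oo[.
Proof.
apply/funext => s; rewrite patchE ysection_under_graph mem_setE in_itv/= andbT.
by case: ifP => // _; rewrite integral_set0.
Qed.

Let layer_cake k theta : measurable_fun setT k ->
  measurable_fun setT theta -> (forall x, 0 <= theta x)%R ->
  measurable_fun ray (layer k theta) /\
  \int[mu]_x (`|k x| * theta x)%R%:E =
    \int[lebesgue_measure]_(s in `[0%R, +oo[) layer k theta s.
Proof.
move=> mk mt t0; have mC := measurable_under_graph mk.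
have mt' : measurable_fun setT (EFin \o theta) by exact/measurable_EFinP.
have t0' x : 0 <= (EFin \o theta) x by rewrite lee_fin.
split.
  apply/measurable_restrictT => //; rewrite -integral_ysectionE.
  exact: (measurable_integral_ysection mu mC mt' t0').
rewrite [RHS]integral_mkcond -integral_ysectionE.
rewrite -(integral_mul_xsection mu lebesgue_measure mC mt' t0').
apply: eq_integral => x _; rewrite mulrC EFinM; congr (_ * _).
transitivity (lebesgue_measure (`[0%R, `|k x|%R[%classic : set R)).
  by rewrite lebesgue_measure_co.
congr (lebesgue_measure _).
apply/seteqP; split => s /=; rewrite in_itv/=.
  by move=> /andP[s0 sk]; apply/xsectionP.
by move=> /xsectionP[/= -> ].
Qed.

Let under_distribution k : set (measurableTypeR R * measurableTypeR R) :=
  [set z | (0 <= z.2)%R /\ (z.1 < distribution k z.2)%R].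

Let measurable_under_distribution k : measurable_fun setT k ->
  measurable (under_distribution k).
Proof.
move=> mk; rewrite -[under_distribution k]setTI.
have -> : under_distribution k =
    (fun z : R * R => (0 <= z.2)%R && (z.1 < distribution k z.2)%R) @^-1` [set true].
  by apply/seteqP; split => z /= => [[-> ->]|/andP].
apply: measurable_and => //.
  by apply: measurable_fun_ler => //; exact: measurable_snd.
apply: measurable_fun_ltr => //.
by apply: measurableT_comp; [exact: measurable_distribution|exact: measurable_snd].
Qed.

Let measure_xsection_distribution k t : measurable_fun setT k ->
  lebesgue_measure (xsection (under_distribution k) t) =
  decreasing_rearrangement mu k t.
Proof.
move=> mk; rewrite rearrangementE//; congr (lebesgue_measure _).
by apply/seteqP; split => s /=; [move=> /xsectionP|move=> ?; apply/xsectionP].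
Qed.

Lemma measurable_rearrangement k : measurable_fun setT k ->
  measurable_fun setT (decreasing_rearrangement mu k).
Proof.
move=> mk; have mC := measurable_under_distribution mk.
have := measurable_fun_xsection lebesgue_measure mC.
congr (measurable_fun _ _); apply/funext => t.
exact: measure_xsection_distribution.
Qed.

Let rlayer k rho s :=
  \int[lebesgue_measure]_(t in `[0%R, fine (mu (superlevel k s))[) rho t.

Let rearrangement_layer_cake k rho : measurable_fun setT k ->
  measurable_fun ray rho -> (forall t, (0 <= t)%R -> 0 <= rho t) ->
  measurable_fun ray (rlayer k rho) /\
  \int[lebesgue_measure]_(t in `[0%R, +oo[)
     (decreasing_rearrangement mu k t * rho t) =
  \int[lebesgue_measure]_(s in `[0%R, +oo[) rlayer k rho s.
Proof.
move=> mk mr r0.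
have mC := measurable_under_distribution mk; set C := under_distribution k in mC *.
have mw : measurable_fun setT (rho \_ `[0%R, +oo[).
  exact/(measurable_restrictT _ _).1.
have w0 t : 0 <= (rho \_ `[0%R, +oo[) t.
  by apply: erestrict_ge0 => s /=; rewrite in_itv/= andbT => /r0.
have rlayerE : (fun s => \int[lebesgue_measure]_(t in ysection C s) (rho \_ `[0%R, +oo[) t)
    = rlayer k rho \_ `[0%R, +oo[.
  apply/funext => s; rewrite patchE mem_setE in_itv/= andbT.
  case: ifPn => s0; last first.
    rewrite (_ : ysection _ _ = set0) ?integral_set0//.
    by apply/seteqP; split => t // /ysectionP[/=]; rewrite (negbTE s0).
  rewrite -integral_mkcondl; congr (integral _ _ _); apply/seteqP; split => t /=;
    rewrite !in_itv/= andbT.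
    by move=> [-> /ysectionP[_ ->]].
  by move=> /andP[-> ?]; split => //; apply/ysectionP.
split.
  apply/measurable_restrictT => //; rewrite -rlayerE.
  exact: (measurable_integral_ysection lebesgue_measure mC mw w0).
rewrite integral_mkcond [RHS]integral_mkcond -rlayerE.
rewrite -(integral_mul_xsection lebesgue_measure lebesgue_measure mC mw w0).
apply: eq_integral => t _; rewrite !patchE mem_setE in_itv/= andbT.
case: ifPn => t0; last by rewrite mul0e.
by rewrite muleC measure_xsection_distribution.
Qed.

(** An inequality holding on every superlevel set of |k| integrates over the
levels: Tonelli's theorem turns the left-hand sides into the integral of
|k| * phi, and the right-hand sides into that of the rearrangement of k times
rho. *)
Lemma layer_cake_le k phi rho : measurable_fun setT k ->
  mu.-integrable setT (EFin \o phi) ->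
  mu.-integrable setT (fun x => (`|k x| * phi x)%R%:E) ->
  measurable_fun ray rho -> (forall t, (0 <= t)%R -> 0 <= rho t) ->
  (forall s, (0 <= s)%R -> 
    \int[mu]_(x in superlevel k s) (phi x)%:E <=
    \int[lebesgue_measure]_(t in `[0%R, fine (mu (superlevel k s))[) rho t) ->
  \int[mu]_x (`|k x| * phi x)%R%:E <=
  \int[lebesgue_measure]_(t in `[0%R, +oo[)
     (decreasing_rearrangement mu k t * rho t).
Proof.
move=> mk iphi ikphi mr r0 layer_le.
have mphi : measurable_fun setT phi by apply/measurable_EFinP; exact: measurable_int iphi.
have mnphi : measurable_fun setT (fun x => `|phi x|)%R by exact: measurableT_comp.
have mtheta : measurable_fun setT (fun x => phi x + `|phi x|)%R by exact: measurable_funD.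
have theta0 x : (0 <= phi x + `|phi x|)%R.
  by rewrite -lerBlDl sub0r; rewrite ler_normr lexx orbT.
have [mL1 L1] := layer_cake mk mtheta theta0.
have [mL2 L2] := layer_cake mk mnphi (fun x => normr_ge0 (phi x)).
have [mL3 L3] := rearrangement_layer_cake mk mr r0.
have iknphi : mu.-integrable setT (fun x => (`|k x| * `|phi x|)%R%:E).
  have := integrable_norm ikphi; apply: eq_integrable => // x _ /=.
  by rewrite normrM normr_id.
(* Tonelli's theorem needs nonnegative integrands: it is applied to
   phi + |phi| and to |phi|, and the difference is finite. *)
have fin : \int[mu]_x (`|k x| * `|phi x|)%R%:E \is a fin_num.
  exact: integrable_fin_num.
rewrite -(leeD2rE _ _ fin) -integralD//.
under eq_integral do rewrite -EFinD -mulrDr.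
rewrite L1 L2 L3 -ge0_integralD//; last 2 first.
- move=> s _; apply: integral_ge0 => t /=; rewrite in_itv/= => /andP[t0 _]; exact: r0.
- by move=> s _; apply: integral_ge0 => x _; rewrite lee_fin.
apply: ge0_le_integral => //.
- by move=> s _; apply: integral_ge0 => x _; rewrite lee_fin.
- exact: emeasurable_funD.
move=> s /=; rewrite in_itv/= andbT => s0.
have mA := measurable_superlevel s mk.
rewrite /layer; under eq_integral do rewrite EFinD.
rewrite integralD//; first by rewrite leeD2r// layer_le.
- exact: integrableS iphi.
- by apply: integrableS (integrable_norm iphi).
Qed.

End layer_cake.

(** * Integrability on a probability space *)

Definition ess_bounded d (T : measurableType d) (R : realType)
    (mu : probability T R) (u : T -> R) :=
  measurable_fun setT u /\ exists M, \forall x \ae mu, `|u x| <= M.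

Section rearrangement_inequality.
Context d (T : measurableType d) (R : realType) (mu : probability T R).
Implicit Types (f g h u v w : T -> R) (A : set T).

Local Notation mfun u := (measurable_fun [set: T] u).
Local Notation mass A := (fine (mu A)).
Local Notation rearr := (decreasing_rearrangement mu).
Local Notation intble u := (mu.-integrable [set: T] (EFin \o u)).

Lemma bounded_ess_bounded u (M : R) : mfun u -> (forall x, `|u x| <= M) -> ess_bounded mu u.
Proof. by move=> meas_u uM; split=> //; exists M; exact: aeW. Qed.

Lemma intble_cst c : intble (fun=> c).
Proof. exact: finite_measure_integrable_cst. Qed.
#[local] Hint Resolve intble_cst : core.

Lemma intble_meas u : intble u -> mfun u.
Proof. by move=> iu; apply/measurable_EFinP; exact: measurable_int iu. Qed.

Lemma intbleD u v : intble u -> intble v -> intble (fun x => u x + v x).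
Proof.
move=> iu iv; have := integrableD measurableT iu iv.
by apply: eq_integrable => //.
Qed.

Lemma intbleB u v : intble u -> intble v -> intble (fun x => u x - v x).
Proof.
move=> iu iv; have := integrableB measurableT iu iv.
by apply: eq_integrable => //.
Qed.

Lemma intbleZ c u : intble u -> intble (fun x => c * u x).
Proof.
move=> iu; have := integrableZl measurableT c iu.
by apply: eq_integrable => //.
Qed.

Lemma intble_norm u : intble u -> intble (fun x => `|u x|).
Proof. exact: integrable_norm. Qed.

Lemma integrable_ess_boundedM u v : ess_bounded mu u -> intble v ->
  intble (fun x => u x * v x).
Proof.
move=> [meas_u [M uM]] iv; have mv := intble_meas iv.
have muv : mfun (fun x => u x * v x) by exact: measurable_funM.
have muv' : measurable_fun setT (EFin \o (fun x => u x * v x)).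
  exact/measurable_EFinP.
have /integrableP[_ fin] : intble (fun x => M * v x) by exact: intbleZ.
apply/integrableP; split => //; apply: le_lt_trans fin.
apply: ae_ge0_le_integral => //.
- by do 2 apply: measurableT_comp => //.
- by do 2 apply: measurableT_comp => //; exact: measurable_funM.
apply: filterS uM => x uM _ /=.
by rewrite lee_fin !normrM ler_wpM2r// (le_trans uM)// ler_norm.
Qed.

Lemma intbleM u v (M : R) : mfun u -> (forall x, `|u x| <= M) -> intble v ->
  intble (fun x => u x * v x).
Proof.
by move=> meas_u uM iv; apply: integrable_ess_boundedM => //; exact: bounded_ess_bounded meas_u uM.
Qed.

Lemma intble_bounded u (M : R) : mfun u -> (forall x, `|u x| <= M) -> intble u.
Proof.
move=> meas_u uM; have := intbleM meas_u uM (intble_cst 1).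
by apply: eq_integrable => // x _ /=; rewrite mulr1.
Qed.

Lemma normr_indic_le A x : `|\1_A x : R| <= 1.
Proof. by rewrite indicE; case: (_ \in _); rewrite ?normr1 ?normr0. Qed.

Lemma mass_ge0 A : 0 <= mass A. Proof. exact: fine_ge0. Qed.

Lemma mass_le1 A : measurable A -> mass A <= 1.
Proof. by move=> mA; rewrite -lee_fin fineK_prob// probability_le1. Qed.

Lemma Rintegral_indic A : measurable A -> \int[mu]_x (\1_A x : R) = mass A.
Proof. by move=> mA; rewrite /Rintegral integral_indic// setIT. Qed.

Lemma Rintegral_cst1 c : \int[mu]_(x in setT) c = c.
Proof.
by rewrite Rintegral_cst// (_ : fine (mu setT) = 1) ?mulr1// probability_setT.
Qed.

(** * The weight *)

(** Both norms are replaced by affine functions of u: |u - c| <= 1 - c u and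
|u + k| <= 1 + k u. With U the integral of u, a = mu A and p the integral of u
over A, the integral of the weight is then at most
a (1 - c U) + a + k p. The choice c = 1 makes this at most 2 a, but the weight
may reach 2 a + 1 - k where u = -1. If that exceeds 2, c is lowered until the
weight equals 2 at u = -1, that is a (1 + c) = 1 + k; the average is still at
most 2 a, because the integral of u outside A is at most 1 - a in absolute
value. *)
Lemma weight_exists_ge0 u A k : mfun u -> (forall x, `|u x| <= 1) ->
  measurable A -> 0 <= \int[mu]_x u x -> `|k| = `|\int[mu]_x u x| ->
  exists c,
    (forall x, mass A * `|u x - c| + \1_A x * `|u x + k| <= 2) /\
    \int[mu]_x (mass A * `|u x - c| + \1_A x * `|u x + k|) <= 2 * mass A.
Proof.
move=> meas_u u1 mA U0.
have m1A : mfun (\1_A : T -> R) by exact: measurable_indic.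
have iu := intble_bounded meas_u u1.
have i1A : intble (\1_A : T -> R) by exact: intble_bounded (normr_indic_le A).
have i1Au : intble (fun x => \1_A x * u x) by exact: intbleM (normr_indic_le A) iu.
set U := \int[mu]_x u x in U0 *; rewrite (ger0_norm U0) => kU.
set a := mass A; have a0 : 0 <= a := mass_ge0 A; have a1 : a <= 1 := mass_le1 mA.
have aE : \int[mu]_x (\1_A x : R) = a by exact: Rintegral_indic.
pose p := \int[mu]_x (\1_A x * u x).
have u1' x : -1 <= u x <= 1 by rewrite -ler_norml.
have U1 : U <= 1.
  rewrite -[leRHS]Rintegral_cst1; apply: le_Rintegral => // x _.
  by have /andP[] := u1' x.
have pa : p <= a.
  rewrite -[leRHS]aE; apply: le_Rintegral => // x _.
  have /andP[? ?] := u1' x.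
  by rewrite indicE; case: (_ \in _); rewrite ?mul1r ?mul0r.
have pa' : - a <= p.
  rewrite -mulN1r -aE -RintegralZl//.
  apply: le_Rintegral => //; first exact: intbleZ.
  move=> x _; have /andP[? ?] := u1' x.
  by rewrite indicE; case: (_ \in _); rewrite ?mul1r ?mul0r ?mulr1 ?mulr0.
have Up : U - p <= 1 - a.
  rewrite -aE -{1}[1]Rintegral_cst1 -!RintegralB//.
  apply: le_Rintegral => //; [exact: intbleB|exact: intbleB|].
  move=> x _; have /andP[? ?] := u1' x.
  by rewrite indicE; case: (_ \in _) => /=; lra.
have Up' : - (1 - a) <= U - p.
  rewrite -aE -{1}[1]Rintegral_cst1 -!RintegralB// -mulN1r -RintegralZl//; last exact: intbleB.
  apply: le_Rintegral => //; [apply: intbleZ; exact: intbleB|exact: intbleB|].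
  move=> x _; have /andP[? ?] := u1' x.
  by rewrite indicE; case: (_ \in _) => /=; lra.
have kk : k = U \/ k = - U.
  by move/eqP: kU; rewrite eqr_norml => /andP[/orP[] /eqP ->]; [left|right].
have mass_bound c : `|c| <= 1 ->
    \int[mu]_x (a * `|u x - c| + \1_A x * `|u x + k|) <=
    a * (1 - c * U) + (a + k * p).
  move=> c1; have : \int[mu]_x (a * (1 - c * u x) + (\1_A x + k * (\1_A x * u x))) =
     a * (1 - c * U) + (a + k * p).
    have icu : intble (fun x => c * u x) by exact: intbleZ.
    have i1cu : intble (fun x => 1 - c * u x) by exact: intbleB.
    have ik1Au : intble (fun x => k * (\1_A x * u x)) by exact: intbleZ.
    rewrite RintegralD//; [|exact: intbleZ|exact: intbleD].
    rewrite RintegralZl// RintegralB// RintegralD// !RintegralZl//.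
    by rewrite Rintegral_cst1 aE.
  move=> <-; apply: le_Rintegral => //.
  - apply: intbleD; first by apply/intbleZ/intble_norm/intbleB.
    exact/(intbleM m1A (normr_indic_le A))/intble_norm/intbleD.
  - by apply: intbleD; [apply/intbleZ/intbleB => //|apply/intbleD => //]; exact: intbleZ.
  move=> x _; have /andP[? ?] := u1' x.
  have k1 : `|k| <= 1 by rewrite kU.
  have norm_le (r s : R) : -1 <= r <= 1 -> `|s| <= 1 -> `|r + s| <= 1 + s * r.
    by move=> /andP[? ?]; rewrite !ler_norml => /andP[? ?]; apply/andP; split; nra.
  apply: lerD.
    by rewrite ler_wpM2l// -mulNr norm_le// normrN.
  rewrite indicE; case: (_ \in _) => /=; last by rewrite !mul0r mulr0 addr0.
  by rewrite !mul1r norm_le.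
have k1 : -1 <= k <= 1 by rewrite -ler_norml kU.
have /andP[k_ge k_le] := k1.
have indic_le x (z : R) : 0 <= z -> \1_A x * z <= z.
  by rewrite indicE; case: (_ \in _) => /= ?; lra.
have normD_le2 (m n : R) : m + n <= 2 -> m - n <= 2 -> n - m <= 2 ->
    - m - n <= 2 -> `|m| + `|n| <= 2.
  by case: (ger0P m); case: (ger0P n); lra.
have [ak|ak] := leP (2 * a) (1 + k).
  exists 1; split.
    move=> x; have /andP[? ?] := u1' x.
    rewrite ler0_norm ?subr_le0// opprB.
    apply: (le_trans (lerD (lexx _) (indic_le _ _ (normr_ge0 _)))).
    rewrite -[X in X + _]ger0_norm; last by rewrite mulr_ge0 ?subr_ge0.
    by apply: normD_le2; nra.
  apply: (le_trans (mass_bound _ _)); first by rewrite normr1.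
  by case: kk => ->; nra.
have a_gt0 : 0 < a by lra.
exists ((1 + k) / a - 1).
have : ((1 + k) / a - 1) * a = 1 + k - a by field; rewrite gt_eqF.
set c := _ / _ - 1 => ca.
have /andP[c_ge c_le] : -1 <= c <= 1 by apply/andP; split; nra.
split.
  move=> x; have /andP[? ?] := u1' x.
  apply: (le_trans (lerD (lexx _) (indic_le _ _ (normr_ge0 _)))).
  rewrite -{1}(ger0_norm a0) -normrM mulrBr (mulrC a c) ca.
  by apply: normD_le2; nra.
apply: (le_trans (mass_bound _ _)); first by rewrite ler_norml c_ge.
rewrite mulrBr mulr1 mulrA (mulrC a c) ca.
by case: kk => ->; nra.
Qed.

(** The case of a negative mean reduces to the previous one by changing the
signs of u, k and c, which leaves the weight unchanged. *)
Lemma weight_exists u A k : mfun u -> (forall x, `|u x| <= 1) ->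
  measurable A -> `|k| = `|\int[mu]_x u x| ->
  exists c,
    (forall x, mass A * `|u x - c| + \1_A x * `|u x + k| <= 2) /\
    \int[mu]_x (mass A * `|u x - c| + \1_A x * `|u x + k|) <= 2 * mass A.
Proof.
move=> meas_u u1 mA kU; have [U0|U0] := leP 0 (\int[mu]_x u x).
  exact: weight_exists_ge0.
have iu : intble u := intble_bounded meas_u u1.
have EN : \int[mu]_x (- u x) = - \int[mu]_x u x.
  have <- : -1 * \int[mu]_x u x = - \int[mu]_x u x by rewrite mulN1r.
  rewrite -RintegralZl//.
  by apply: eq_Rintegral => x _; rewrite mulN1r.
have mN : mfun (fun x => - u x) by exact: measurableT_comp.
have N1 x : `|- u x| <= 1 by rewrite normrN.
have IN0 : 0 <= \int[mu]_x (- u x) by rewrite EN oppr_ge0 ltW.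
have kN : `|- k| = `|\int[mu]_x (- u x)| by rewrite EN !normrN.
have [c [W2 IW]] := weight_exists_ge0 mN N1 mA IN0 kN.
have swap x : mass A * `|- u x - c| + \1_A x * `|- u x - k| =
    mass A * `|u x - - c| + \1_A x * `|u x + k|.
  by rewrite -!opprD !normrN opprK.
exists (- c); split => [x|]; first by rewrite -swap.
by under eq_Rintegral do rewrite -swap.
Qed.

(** Form of the Hardy-Littlewood inequality: a weight bounded by 2 with total
mass at most 2 a has integral at most 2 min(a, mu E) on every set E, which
is the integral over [0, mu E[ of twice the indicator of [0, a[. *)
Lemma weighted_integral_le g w (a : R) : intble g -> mfun w -> 0 <= a ->
  (forall x, 0 <= w x <= 2) -> \int[mu]_x w x <= 2 * a ->
  ((\int[mu]_x (`|g x| * w x))%:E <=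
   \int[lebesgue_measure]_(t in `[0%R, a[) (2%:E * rearr g t))%E.
Proof.
move=> ig mw a0 w02 Iw.
have w2 x : `|w x| <= 2 by have /andP[? ?] := w02 x; rewrite ger0_norm.
have iw : intble w := intble_bounded mw w2.
have igw : intble (fun x => `|g x| * w x).
  have := intbleM mw w2 (intble_norm ig); apply: eq_integrable => // x _ /=.
  by rewrite mulrC.
rewrite /Rintegral fineK; last exact: integrable_fin_num.
pose rho : R -> \bar R := (cst 2%:E) \_ `[0%R, a[.
have mrho : measurable_fun (`[0%R, +oo[ : set R) rho.
  apply: measurable_funTS; apply/(measurable_restrictT _ _).1 => //.
have rho0 t : 0 <= t -> (0 <= rho t)%E.
  by move=> _; apply: erestrict_ge0 => s _; rewrite lee_fin.
have -> : (\int[lebesgue_measure]_(t in `[0%R, a[) (2%:E * rearr g t) =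
    \int[lebesgue_measure]_(t in `[0%R, +oo[) (rearr g t * rho t))%E.
  rewrite integral_mkcond [RHS]integral_mkcond; apply: eq_integral => t _.
  rewrite /rho !patchE !mem_setE !in_itv/= andbT.
  case: (0 <= t) => //=; case: ifP; by rewrite ?mule0// muleC.
apply: layer_cake_le => //; first exact: intble_meas ig.
move=> s s0; set A := superlevel g s.
have mA : measurable A by apply: measurable_superlevel; exact: intble_meas ig.
have -> : (\int[lebesgue_measure]_(t in `[0%R, mass A[) rho t =
   (2 * Num.min a (mass A))%:E)%E.
  rewrite /rho -integral_mkcondr.
  have -> : `[0%R, mass A[ `&` `[0%R, a[ = (`[0%R, Num.min a (mass A)[ : set R)%classic.
    apply/seteqP; split => t /=; rewrite !in_itv/= lt_min.
      by move=> [/andP[-> ->]] /andP[_ ->].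
    by move=> /andP[-> /andP[-> ->]].
  rewrite integral_cst// EFinM; congr (_ * _)%E.
  by apply: lebesgue_measure_co; rewrite le_min a0 fine_ge0.
have iwA : mu.-integrable A (EFin \o w).
  exact: (integrableS measurableT mA (@subsetT _ A) iw).
have -> : (\int[mu]_(x in A) (w x)%:E = (\int[mu]_(x in A) w x)%:E)%E.
  by rewrite /Rintegral fineK//; exact: integrable_fin_num.
rewrite lee_fin; case: (leP a (mass A)) => _.
  apply: le_trans Iw; rewrite Rintegral_mkcond; apply: le_Rintegral => //.
    have := (integrable_mkcond (EFin \o w) mA).1 iwA.
    by rewrite restrict_EFin.
  move=> x _; rewrite patchE; case: ifP => // _.
  by have /andP[] := w02 x.
rewrite -Rintegral_cst//; apply: le_Rintegral => //.
  exact: (integrableS measurableT mA (@subsetT _ A) (intble_cst 2)).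
by move=> x _; have /andP[] := w02 x.
Qed.

(** As g has mean zero, u may be replaced by u - c in the first integral, for
any constant c; the expression is therefore bounded by the integral of |g|
against the weight mu(A) |u - c| + 1_A |u + k|. *)
Lemma mean_zero_bilinear_le g u v A k sigma : intble g -> \int[mu]_x g x = 0 ->
  mfun u -> (forall x, `|u x| <= 1) ->
  mfun v -> measurable A -> (forall x, `|v x| <= \1_A x) ->
  `|k| = `|\int[mu]_x u x| -> `|sigma| <= 1 ->
  ((sigma * \int[mu]_x (u x * g x) * \int[mu]_x v x
      - \int[mu]_x (v x * ((u x + k) * g x)))%:E <=
   \int[lebesgue_measure]_(t in `[0%R, mass A[) (2%:E * rearr g t))%E.
Proof.
move=> ig Ig0 meas_u u1 mv mA vA kU s1.
have [c [W2 IW]] := weight_exists meas_u u1 mA kU.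
set W := fun x => mass A * `|u x - c| + \1_A x * `|u x + k|.
have mA0 : 0 <= mass A by exact: fine_ge0.
have m1A : mfun (\1_A : T -> R) by exact: measurable_indic.
have muc : mfun (fun x => `|u x - c|) by apply: measurableT_comp => //; exact: measurable_funB.
have muk : mfun (fun x => `|u x + k|) by apply: measurableT_comp => //; exact: measurable_funD.
have mW : mfun W.
  by apply: measurable_funD; apply: measurable_funM.
have W0 x : 0 <= W x <= 2.
  by rewrite W2 andbT addr_ge0// mulr_ge0.
have := weighted_integral_le ig mW mA0 W0 IW; apply: le_trans; rewrite lee_fin.
have v1 x : `|v x| <= 1.
  by rewrite (le_trans (vA x))// indicE; case: (_ \in _) => //=.
have iug := intbleM meas_u u1 ig.
have iucg : intble (fun x => (u x - c) * g x).
  have := intbleB iug (intbleZ c ig); apply: eq_integrable => // x _ /=.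
  by rewrite mulrBl.
have iukg : intble (fun x => (u x + k) * g x).
  have := intbleD iug (intbleZ k ig); apply: eq_integrable => // x _ /=.
  by rewrite mulrDl.
have ivukg := intbleM mv v1 iukg.
have iv : intble v := intble_bounded mv v1.
have i1A : intble (\1_A : T -> R) by exact: intble_bounded m1A (normr_indic_le A).
have E1 : `|\int[mu]_x (u x * g x)| <= \int[mu]_x `|(u x - c) * g x|.
  rewrite (_ : \int[mu]_x (u x * g x) = \int[mu]_x ((u x - c) * g x)).
    exact: le_normr_Rintegral.
  under [RHS]eq_Rintegral do rewrite mulrBl.
  by rewrite RintegralB// ?RintegralZl// ?Ig0 ?mulr0 ?subr0//; exact: intbleZ.
have E2 : `|\int[mu]_x v x| <= mass A.
  apply: (le_trans (le_normr_Rintegral _ _)) => //.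
  rewrite -(Rintegral_indic mA); apply: le_Rintegral => //; exact: intble_norm.
have i2 : intble (fun x => \1_A x * `|(u x + k) * g x|).
  exact/(intbleM m1A (normr_indic_le A))/intble_norm.
have E3 : `|\int[mu]_x (v x * ((u x + k) * g x))| <=
   \int[mu]_x (\1_A x * `|(u x + k) * g x|).
  apply: (le_trans (le_normr_Rintegral _ _)) => //.
  apply: le_Rintegral => //; first exact: intble_norm.
  by move=> x _; rewrite normrM ler_wpM2r.
have -> : \int[mu]_x (`|g x| * W x) = mass A * \int[mu]_x `|(u x - c) * g x| +
   \int[mu]_x (\1_A x * `|(u x + k) * g x|).
  rewrite -RintegralZl//; last exact: intble_norm.
  rewrite -RintegralD//; last by apply/intbleZ/intble_norm.
  by apply: eq_Rintegral => x _; rewrite !normrM /W; ring.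
apply: (le_trans (ler_norm _)); apply: (le_trans (ler_normB _ _)).
apply: lerD => //; rewrite !normrM mulrC ler_pM// ?mulr_ge0//.
by rewrite -[leRHS]mul1r ler_pM.
Qed.

(** * Passing from layers to functions *)

Lemma measurable_sgr u : mfun u -> mfun (fun x => Num.sg (u x)).
Proof.
move=> meas_u; have -> : (fun x => Num.sg (u x)) =
    (fun x => (0 < u x)%R%:R - (u x < 0)%R%:R).
  by apply/funext => x; case: sgrP => _ /=; rewrite ?subr0 ?sub0r.
have mb (b : T -> bool) : measurable_fun setT b -> mfun (fun x => (b x)%:R : R).
  move=> mb; have -> : (fun x => (b x)%:R : R) = \1_[set x | b x].
    by apply/funext => x; rewrite indicE mem_setE.
  apply: measurable_indic; rewrite -[X in measurable X]setTI.
  rewrite (_ : [set x | b x] = b @^-1` [set true]); first exact: mb.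
  by apply/seteqP; split => x /=.
by apply: measurable_funB; apply: mb; exact: measurable_fun_ltr.
Qed.

Definition sign_layer u s x : R := \1_(superlevel u s) x * Num.sg (u x).

Lemma sign_layer_le u s x : `|sign_layer u s x| <= \1_(superlevel u s) x.
Proof.
rewrite /sign_layer normrM normr_sg indicE.
by case: (_ \in _); case: (u x != 0); rewrite /= ?normr1 ?normr0 ?mulr1 ?mul0r ?mulr0.
Qed.

Lemma measurable_sign_layer u s : mfun u -> mfun (sign_layer u s).
Proof.
move=> meas_u; apply: measurable_funM; last exact: measurable_sgr.
by apply: measurable_indic; exact: measurable_superlevel.
Qed.

Lemma indic_le1 A x : (\1_A x : R) <= 1.
Proof. by rewrite indicE; case: (_ \in _). Qed.

(** A linear functional of u, given by a density phi, is controlled by its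
values on the layers of u. A layer carries the sign of u, so that the layers
add up to u itself and not to |u|. *)
Lemma le_layerwise u phi (rho : R -> \bar R) : mfun u -> intble phi ->
  intble (fun x => u x * phi x) ->
  measurable_fun (`[0%R, +oo[%classic : set R) rho ->
  (forall t, 0 <= t -> (0 <= rho t)%E) ->
  (forall s, 0 <= s -> ((\int[mu]_x (sign_layer u s x * phi x))%:E <=
    \int[lebesgue_measure]_(t in `[0%R, mass (superlevel u s)[) rho t)%E) ->
  ((\int[mu]_x (u x * phi x))%:E <=
    \int[lebesgue_measure]_(t in `[0%R, +oo[) (rearr u t * rho t))%E.
Proof.
move=> meas_u iphi iuphi mrho rho0 layer_le.
have sg1 x : `|Num.sg (u x)| <= 1.
  by rewrite normr_sg; case: (u x != 0) => /=.
have isphi : intble (fun x => Num.sg (u x) * phi x).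
  exact: (intbleM (measurable_sgr meas_u) sg1 iphi).
have E x : `|u x| * (Num.sg (u x) * phi x) = u x * phi x.
  by rewrite mulrA [_ * Num.sg _]mulrC -numEsg.
rewrite /Rintegral fineK; last exact: integrable_fin_num.
under eq_integral do rewrite -E.
apply: layer_cake_le => //.
  by apply: eq_integrable iuphi => // x _ /=; rewrite E.
move=> s s0; apply: le_trans (layer_le s s0).
have mA := measurable_superlevel s meas_u.
rewrite /Rintegral fineK; last first.
  apply: integrable_fin_num => //.
  apply: (intbleM (measurable_sign_layer s meas_u) _ iphi) => x.
  exact: le_trans (sign_layer_le u s x) (indic_le1 _ _).
rewrite [leLHS]integral_mkcond le_eqVlt; apply/orP; left; apply/eqP.
apply: eq_integral => x _; rewrite patchE /sign_layer indicE.
by case: ifP => _; rewrite ?mul1r ?mul0r.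
Qed.

(** * The trilinear form *)

(** The value of the double integral of the theorem when g has mean zero. *)
Definition trilinear_form f g h : R := \int[mu]_x (f x * g x) * \int[mu]_x h x
  - \int[mu]_x f x * \int[mu]_x (g x * h x) - \int[mu]_x (f x * g x * h x).

(** Densities representing the form as a linear functional of its first,
respectively third, argument. *)
Definition kernel_fst g h x := \int[mu]_y h y * g x - \int[mu]_y (g y * h y) - g x * h x.
Definition kernel_trd f g y := \int[mu]_x (f x * g x) - \int[mu]_x f x * g y - f y * g y.

Section kernels.
Context f g h (bf : ess_bounded mu f) (bg : ess_bounded mu g) (ih : intble h).

Lemma ess_bounded_intble u : ess_bounded mu u -> intble u.
Proof.
move=> bu; have := integrable_ess_boundedM bu (intble_cst 1).
by apply: eq_integrable => // x _ /=; rewrite mulr1.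
Qed.

Let i_f : intble f := ess_bounded_intble bf.
Let i_g : intble g := ess_bounded_intble bg.
Let ifg : intble (fun x => f x * g x). Proof. exact: integrable_ess_boundedM. Qed.
Let igh : intble (fun x => g x * h x). Proof. exact: integrable_ess_boundedM. Qed.
Let ifgh : intble (fun x => f x * g x * h x).
Proof.
have := integrable_ess_boundedM bf igh; apply: eq_integrable => // x _ /=.
by rewrite mulrA.
Qed.
Let igHJ : intble (fun x => \int[mu]_y h y * g x - \int[mu]_y (g y * h y)).
Proof. by apply: intbleB => //; exact: intbleZ. Qed.
Let iDFg : intble (fun y => \int[mu]_x (f x * g x) - \int[mu]_x f x * g y).
Proof. by apply: intbleB => //; exact: intbleZ. Qed.

Lemma intble_kernel_fst : intble (kernel_fst g h).
Proof. exact: intbleB. Qed.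

Lemma intble_kernel_trd : intble (kernel_trd f g).
Proof. exact: intbleB. Qed.

Lemma intble_kernel_fstM : intble (fun x => f x * kernel_fst g h x).
Proof. exact/integrable_ess_boundedM/intble_kernel_fst. Qed.

Lemma intble_kernel_trdM : intble (fun x => h x * kernel_trd f g x).
Proof.
have := intbleB (intbleB (intbleZ (\int[mu]_x (f x * g x)) ih)
  (intbleZ (\int[mu]_x f x) igh)) ifgh.
by apply: eq_integrable => // x _ /=; congr EFin; rewrite /kernel_trd; ring.
Qed.

Lemma trilinear_form_fstE : trilinear_form f g h = \int[mu]_x (f x * kernel_fst g h x).
Proof.
have -> : \int[mu]_x (f x * kernel_fst g h x) = \int[mu]_x
    (\int[mu]_y h y * (f x * g x) - \int[mu]_y (g y * h y) * f x - f x * g x * h x).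
  by apply: eq_Rintegral => x _; rewrite /kernel_fst; ring.
have i1 : intble (fun x => \int[mu]_y h y * (f x * g x)) by exact: intbleZ.
have i2 : intble (fun x => \int[mu]_y (g y * h y) * f x) by exact: intbleZ.
have i3 := intbleB i1 i2.
rewrite RintegralB// RintegralB// !RintegralZl// /trilinear_form; ring.
Qed.

Lemma trilinear_form_trdE : trilinear_form f g h = \int[mu]_x (h x * kernel_trd f g x).
Proof.
have -> : \int[mu]_x (h x * kernel_trd f g x) = \int[mu]_x
    (\int[mu]_y (f y * g y) * h x - \int[mu]_y f y * (g x * h x) - f x * g x * h x).
  by apply: eq_Rintegral => x _; rewrite /kernel_trd; ring.
have i1 : intble (fun x => \int[mu]_y (f y * g y) * h x) by exact: intbleZ.
have i2 : intble (fun x => \int[mu]_y f y * (g x * h x)) by exact: intbleZ.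
have i3 := intbleB i1 i2.
rewrite RintegralB// RintegralB// !RintegralZl// /trilinear_form; ring.
Qed.

End kernels.

Section bound.
Context g (bg : ess_bounded mu g) (Ig0 : \int[mu]_x g x = 0).
Let i_g : intble g := ess_bounded_intble bg.

(** The form is an instance of mean_zero_bilinear_le in two ways: with v = f,
u = h and k the opposite of the mean of h, or with v = h, u = f and k the mean
of f. The first gives the bound for mu A, the second the bound for mu B; the
smaller one is kept. *)
Lemma trilinear_form_le_indic f h A B : mfun f -> mfun h ->
  measurable A -> measurable B ->
  (forall x, `|f x| <= \1_A x) -> (forall x, `|h x| <= \1_B x) ->
  ((trilinear_form f g h)%:E <= \int[lebesgue_measure]_(t in `[0%R, mass B[)
     ((fun t => 2%:E * rearr g t)%E \_ `[0%R, mass A[) t)%E.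
Proof.
move=> mf mh mA mB fA hB.
have f1 x : `|f x| <= 1 by exact: le_trans (fA x) (indic_le1 _ _).
have h1 x : `|h x| <= 1 by exact: le_trans (hB x) (indic_le1 _ _).
have bf : ess_bounded mu f := bounded_ess_bounded mf f1.
have bh : ess_bounded mu h := bounded_ess_bounded mh h1.
have ifg : intble (fun x => f x * g x) by exact: integrable_ess_boundedM.
have ihg : intble (fun x => h x * g x) by exact: integrable_ess_boundedM.
have ih : intble h := ess_bounded_intble bh.
have i_f : intble f := ess_bounded_intble bf.
have ghE : \int[mu]_x (g x * h x) = \int[mu]_x (h x * g x).
  by apply: eq_Rintegral => x _; rewrite mulrC.
rewrite -integral_mkcondr; case: (leP (mass A) (mass B)) => AB.
- rewrite (_ : _ `&` _ = (`[0%R, mass A[%classic : set R)); last first.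
    apply/seteqP; split => t /=; rewrite !in_itv/=; first by move=> [].
    by move=> /andP[-> tA]; rewrite tA (lt_le_trans tA).
  have kH : `|- \int[mu]_x h x| = `|\int[mu]_x h x| by rewrite normrN.
  have s1 : `|-1 : R| <= 1 by rewrite normrN normr1.
  apply: le_trans (mean_zero_bilinear_le i_g Ig0 mh h1 mf mA fA kH s1).
  rewrite lee_fin le_eqVlt; apply/orP; left; apply/eqP.
  have -> : \int[mu]_x (f x * ((h x + - \int[mu]_x h x) * g x)) =
     \int[mu]_x (f x * g x * h x - \int[mu]_x h x * (f x * g x)).
    by apply: eq_Rintegral => x _; ring.
  rewrite RintegralB//; last 2 first.
  + have := integrable_ess_boundedM bh ifg; apply: eq_integrable => // x _ /=.
    by rewrite mulrC.
  + exact: intbleZ.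
  by rewrite RintegralZl// /trilinear_form ghE; ring.
- rewrite (_ : _ `&` _ = (`[0%R, mass B[%classic : set R)); last first.
    apply/seteqP; split => t /=; rewrite !in_itv/=; first by move=> [].
    by move=> /andP[-> tA]; rewrite tA (lt_trans tA).
  have s1 : `|1 : R| <= 1 by rewrite normr1.
  apply: le_trans (mean_zero_bilinear_le i_g Ig0 mf f1 mh mB hB erefl s1).
  rewrite lee_fin le_eqVlt; apply/orP; left; apply/eqP.
  have -> : \int[mu]_x (h x * ((f x + \int[mu]_x f x) * g x)) =
     \int[mu]_x (f x * g x * h x + \int[mu]_x f x * (h x * g x)).
    by apply: eq_Rintegral => x _; ring.
  rewrite RintegralD//; last 2 first.
  + have := integrable_ess_boundedM bh ifg; apply: eq_integrable => // x _ /=.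
    by rewrite mulrC.
  + exact: intbleZ.
  by rewrite RintegralZl// /trilinear_form ghE; ring.
Qed.

Lemma measurable_rearr_ray u : mfun u -> measurable_fun (`[0%R, +oo[%classic : set R) (rearr u).
Proof. by move=> meas_u; apply: measurable_funTS; exact: measurable_rearrangement. Qed.

(** The bound on indicators, integrated over the layers of h. *)
Lemma trilinear_form_le_bounded f h A : mfun f -> measurable A ->
  (forall x, `|f x| <= \1_A x) -> intble h ->
  ((trilinear_form f g h)%:E <= \int[lebesgue_measure]_(t in `[0%R, mass A[)
     (2%:E * rearr g t * rearr h t))%E.
Proof.
move=> mf mA fA ih; have mh := intble_meas ih; have mg := intble_meas i_g.
have f1 x : `|f x| <= 1 by exact: le_trans (fA x) (indic_le1 _ _).
have bf : ess_bounded mu f := bounded_ess_bounded mf f1.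
pose rho : R -> \bar R := (fun t => 2%:E * rearr g t)%E \_ `[0%R, mass A[.
have -> : (\int[lebesgue_measure]_(t in `[0%R, mass A[)
     (2%:E * rearr g t * rearr h t) =
     \int[lebesgue_measure]_(t in `[0%R, +oo[) (rearr h t * rho t))%E.
  rewrite integral_mkcond [RHS]integral_mkcond; apply: eq_integral => t _.
  rewrite /rho !patchE !mem_setE !in_itv/= andbT.
  case: (0 <= t) => //=; case: ifP; by rewrite ?mule0// muleC.
rewrite trilinear_form_trdE//; apply: le_layerwise => //.
- exact: intble_kernel_trd.
- exact: intble_kernel_trdM.
- apply: measurable_funTS; apply/(measurable_restrictT _ _).1 => //.
  apply: measurable_funTS; apply: emeasurable_funM => //.
  exact: measurable_rearrangement.
- move=> t _; apply: erestrict_ge0 => s _.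
  by rewrite mule_ge0// rearrangement_ge0.
move=> s s0; have mB := measurable_superlevel s mh.
have mhs := measurable_sign_layer s mh.
rewrite -trilinear_form_trdE//.
  exact: (trilinear_form_le_indic mf mhs mA mB fA (sign_layer_le h s)).
apply: (intble_bounded mhs) => x.
exact: le_trans (sign_layer_le h s x) (indic_le1 _ _).
Qed.

(** The previous bound, integrated over the layers of f. *)
Lemma trilinear_form_le f h : ess_bounded mu f -> intble h ->
  ((trilinear_form f g h)%:E <= \int[lebesgue_measure]_(t in `[0%R, +oo[)
     (rearr f t * (2%:E * rearr g t * rearr h t)))%E.
Proof.
move=> bf ih; have mh := intble_meas ih; have mg := intble_meas i_g.
have mf := bf.1.
rewrite trilinear_form_fstE//; apply: le_layerwise => //.
- exact: intble_kernel_fst.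
- exact: intble_kernel_fstM.
- apply: emeasurable_funM; last exact: measurable_rearr_ray.
  by apply: emeasurable_funM => //; exact: measurable_rearr_ray.
- by move=> t _; rewrite !mule_ge0// rearrangement_ge0.
move=> s s0; have mA := measurable_superlevel s mf.
have mfs := measurable_sign_layer s mf.
rewrite -trilinear_form_fstE//; first exact: (trilinear_form_le_bounded mfs mA (sign_layer_le f s)).
apply: (bounded_ess_bounded mfs) => x.
exact: le_trans (sign_layer_le f s x) (indic_le1 _ _).
Qed.

End bound.

End rearrangement_inequality.

(** * The double integral *)

Section product_integral.
Context d (T : measurableType d) {R : realType} {mu : probability T R}.
Local Notation intble u := (mu.-integrable [set: T] (EFin \o u)).
Local Notation intble2 w := ((mu \x mu)%E.-integrable [set: T * T] (EFin \o w)).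
Implicit Types u v : T -> R.

Lemma integrable_prodM u v : intble u -> intble v ->
  intble2 (fun z => u z.1 * v z.2).
Proof.
move=> iu iv; have meas_u := intble_meas iu; have mv := intble_meas iv.
have m2 : measurable_fun setT (EFin \o (fun z : T * T => u z.1 * v z.2)).
  apply/measurable_EFinP; apply: measurable_funM; exact: measurableT_comp.
apply/(integrable12ltyP mu mu m2) => /=.
have -> : (fun x => \int[mu]_y `|(u x * v y)%:E|)%E =
    (fun x => `|u x|%:E * \int[mu]_y `|(v y)%:E|)%E.
  apply/funext => x; rewrite -ge0_integralZl//; last first.
    by do 2 apply: measurableT_comp => //.
  by apply: eq_integral => y _; rewrite EFinM abseM.
rewrite ge0_integralZr//; last 2 first.
- by do 2 apply: measurableT_comp => //.
- exact: integral_ge0.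
have /integrableP[_ fu] := iu; have /integrableP[_ fv] := iv.
by apply: lte_mul_pinfty => //; [exact: integral_ge0|rewrite ge0_fin_numE//; exact: integral_ge0].
Qed.

Lemma Rintegral_prodM u v : intble u -> intble v ->
  \int[(mu \x mu)%E]_z (u z.1 * v z.2) = \int[mu]_x u x * \int[mu]_x v x.
Proof.
move=> iu iv; rewrite {1}/Rintegral -integral12_prod_meas1; last exact: integrable_prodM.
rewrite /fubini_F/=.
have -> : (fun x => \int[mu]_y (u x * v y)%:E)%E =
    (fun x => (u x)%:E * (\int[mu]_y v y)%:E)%E.
  apply/funext => x; rewrite /Rintegral fineK; last exact: integrable_fin_num.
  by rewrite -integralZl//; apply: eq_integral => y _; rewrite EFinM.
rewrite integralZr// fineM//; exact: integrable_fin_num.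
Qed.

End product_integral.

Lemma Lfun_ess_bounded d (T : measurableType d) (R : realType)
    (mu : probability T R) (u : T -> R) :
  u \in Lfun mu +oo%E -> ess_bounded mu u.
Proof.
rewrite inE => /andP[/[!inE]/= meas_u finu]; split => //.
have meas_ugt0 : (0 < mu [set: T])%E by rewrite probability_setT.
move: finu; rewrite /finite_norm unlock /Lnorm; case: ifPn => [_|/negP//].
exact: ess_supr_bounded.
Qed.

Theorem theorem3p2 (d : measure_display) (T : measurableType d) (R : realType)
    (mu : probability T R) (f g h : T -> R)
    (hf : f \in Lfun mu +oo%E) (hg : g \in Lfun mu +oo%E)
    (hh : h \in Lfun mu 1%:E)
    (hg0 : (\int[mu]_x (g x)%:E = 0)%E) :
  (\int[mu \x mu]_z
      ((f z.1 + f z.2) * (g z.1 - g z.2) * h z.2)%R%:E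
   <= 2%:E * \int[lebesgue_measure]_(y in `[0%R, +oo[)
      (decreasing_rearrangement mu f y * decreasing_rearrangement mu g y *
       decreasing_rearrangement mu h y))%E.
Proof.
have bf := Lfun_ess_bounded hf; have bg := Lfun_ess_bounded hg.
have ih : mu.-integrable setT (EFin \o h) by exact/Lfun1_integrable.
have i_f := ess_bounded_intble bf; have ig := ess_bounded_intble bg.
have ifg := integrable_ess_boundedM bf ig.
have igh := integrable_ess_boundedM bg ih.
have ifh := integrable_ess_boundedM bf ih.
have ifgh := integrable_ess_boundedM bf igh.
have Ig0 : \int[mu]_x g x = 0 by rewrite /Rintegral hg0.
have i1 := integrable_prodM ifg ih.
have i2 := integrable_prodM i_f igh.
have i3 := integrable_prodM ig ifh.
have i4 := integrable_prodM (intble_cst mu 1) ifgh.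
have i12 : (mu \x mu)%E.-integrable setT (EFin \o (fun z : T * T =>
    f z.1 * g z.1 * h z.2 - f z.1 * (g z.2 * h z.2))).
  have := integrableB measurableT i1 i2; exact: eq_integrable.
have i123 : (mu \x mu)%E.-integrable setT (EFin \o (fun z : T * T =>
    f z.1 * g z.1 * h z.2 - f z.1 * (g z.2 * h z.2) + g z.1 * (f z.2 * h z.2))).
  have := integrableD measurableT i12 i3; exact: eq_integrable.
have i1234 : (mu \x mu)%E.-integrable setT (EFin \o (fun z : T * T =>
    f z.1 * g z.1 * h z.2 - f z.1 * (g z.2 * h z.2) + g z.1 * (f z.2 * h z.2)
    - 1 * (f z.2 * (g z.2 * h z.2)))).
  have := integrableB measurableT i123 i4; exact: eq_integrable.
have -> : (\int[mu \x mu]_z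
      ((f z.1 + f z.2) * (g z.1 - g z.2) * h z.2)%R%:E = (trilinear_form mu f g h)%:E)%E.
  transitivity (\int[(mu \x mu)%E]_z
    (f z.1 * g z.1 * h z.2 - f z.1 * (g z.2 * h z.2) + g z.1 * (f z.2 * h z.2)
    - 1 * (f z.2 * (g z.2 * h z.2))))%:E.
    rewrite /Rintegral fineK; last exact: integrable_fin_num.
    by apply: eq_integral => z _; congr EFin; ring.
  have /= E1 := Rintegral_prodM ifg ih.
  have /= E2 := Rintegral_prodM i_f igh.
  have /= E3 := Rintegral_prodM ig ifh.
  have /= E4 := Rintegral_prodM (intble_cst mu 1) ifgh.
  rewrite RintegralB// RintegralD// RintegralB// E1 E2 E3 E4 Ig0.
  rewrite Rintegral_cst1 mul0r addr0 mul1r /trilinear_form.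
  congr (_ - _)%:E.
  by apply: eq_Rintegral => x _; rewrite mulrA.
apply: (le_trans (trilinear_form_le bg Ig0 bf ih)).
have mg := bg.1; have mf := bf.1; have mh := intble_meas ih.
rewrite -ge0_integralZl//.
- rewrite le_eqVlt; apply/orP; left; apply/eqP; apply: eq_integral => t _.
  by rewrite -!muleA; exact: muleCA.
- apply: emeasurable_funM; last exact: measurable_rearr_ray.
  by apply: emeasurable_funM; exact: measurable_rearr_ray.
- by move=> t _; rewrite !mule_ge0// rearrangement_ge0.
Qed.
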